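(* Let $G$ be a finite simple graph with vertex set $[n]=\{1,\dots,n\}$, $n\ge 1$, and let $\mathcal{P}_G\subset\mathbb{R}^n$ be its stable set polytope. Then $$\omega(G)+1\le \operatorname{codeg}(\mathcal{P}_G)\le \chi(G)+1,$$ where $\omega(G)$ and $\chi(G)$ denote the clique number and the chromatic number of $G$, respectively. In particular, if $G$ is perfect, then $$\omega(G)+1=\operatorname{codeg}(\mathcal{P}_G)=\chi(G)+1.$$
   Context: A stable set of $G$ is a subset $S\subset[n]$ such that no two distinct elements of $S$ are adjacent (the empty set and all singletons are stable). For $A\subset[n]$ let $\mathbf{e}_A=\sum_{i\in A}\mathbf{e}_i\in\mathbb{R}^n$ be its indicator vector, where $\mathbf{e}_i$ is the $i$-th unit coordinate vector. The stable set polytope is $\mathcal{P}_G=\operatorname{conv}\{\mathbf{e}_S : S \text{ a stable set of } G\}\subset\mathbb{R}^n$; it is a full-dimensional lattice polytope. For a full-dimensional lattice polytope $\mathcal{P}\subset\mathbb{R}^n$ (a convex polytope all of whose vertices have integer coordinates), the codegree $\operatorname{codeg}(\mathcal{P})$ is the smallest positive integer $k$ such that the interior of the dilate $k\mathcal{P}$ contains a point of $\mathbb{Z}^n$. The clique number $\omega(G)$ is the maximal cardinality of a set of pairwise adjacent vertices. The chromatic number $\chi(G)$ is the least $k$ such that there is a map $f:[n]\to[k]$ with $f(i)\ne f(j)$ for every edge $\{i,j\}$. $G$ is perfect if $\omega(H)=\chi(H)$ for every induced subgraph $H$ of $G$. *)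

(* Defs.v *)
From HB Require Import structures.
From mathcomp Require Import all_boot all_order all_algebra.
From mathcomp Require Import all_classical all_reals all_analysis.

Set Implicit Arguments.
Unset Strict Implicit.
Unset Printing Implicit Defensive.

Import Order.TTheory GRing.Theory Num.Theory.
Import numFieldNormedType.Exports.

Local Open Scope classical_set_scope.
Local Open Scope ring_scope.

Record sgraph (V : finType) := SGraph {
  edge : rel V;
  edge_sym : symmetric edge;
  edge_irr : irreflexive edge }.

Section Graphs.
Variables (V : finType) (G : sgraph V).

Definition stable (S : {set V}) : bool :=
  [forall i in S, forall j in S, (i != j) ==> ~~ edge G i j].

Definition clique (K : {set V}) : bool :=
  [forall i in K, forall j in K, (i != j) ==> edge G i j].

Definition clique_number : nat := (\max_(K : {set V} | clique K) #|K|)%N.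

Definition colorable (k : nat) : bool :=
  [exists f : {ffun V -> 'I_k},
    [forall i, forall j, edge G i j ==> (f i != f j)]].

Lemma colorable_ex : exists k, colorable k.
Proof.
exists #|V|; apply/existsP; exists [ffun x => enum_rank x].
apply/forallP => i; apply/forallP => j; apply/implyP => eij.
rewrite !ffunE (inj_eq enum_rank_inj); apply/eqP => ij.
by rewrite ij (edge_irr G) in eij.
Qed.

Definition chromatic_number : nat := ex_minn colorable_ex.

Section Induced.
Variable A : {set V}.

Definition induced_edge : rel {x : V | x \in A} :=
  fun x y => edge G (val x) (val y).

Lemma induced_edge_sym : symmetric induced_edge.
Proof. by move=> x y; apply: edge_sym. Qed.

Lemma induced_edge_irr : irreflexive induced_edge.
Proof. by move=> x; apply: edge_irr. Qed.

Definition induced : sgraph {x : V | x \in A} :=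
  SGraph induced_edge_sym induced_edge_irr.

End Induced.
End Graphs.

Definition perfect (V : finType) (G : sgraph V) : Prop :=
  forall A : {set V},
    clique_number (induced G A) = chromatic_number (induced G A).

Section Polytopes.
Variables (R : realType) (n : nat).

Definition convex_hull (X : set 'rV[R]_n) : set 'rV[R]_n :=
  smallest (fun C : set 'rV[R]_n => convex_set C) X.

Definition indicator_vector (A : {set 'I_n}) : 'rV[R]_n :=
  \sum_(i in A) delta_mx 0 i.

Definition stable_set_polytope (G : sgraph 'I_n) : set 'rV[R]_n :=
  convex_hull [set indicator_vector S | S in [set S | stable G S]].

Definition dilate (k : nat) (P : set 'rV[R]_n) : set 'rV[R]_n :=
  [set k%:R *: x | x in P].

Definition lattice_point (x : 'rV[R]_n) : Prop :=
  forall i, x 0 i \is a Num.int.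

Definition interior_lattice_dilate (P : set 'rV[R]_n) (k : nat) : Prop :=
  (0 < k)%N /\ exists x, lattice_point x /\ interior (dilate k P) x.

(* The value is 0 when no dilate of P has an interior lattice point; this does
   not happen for a full-dimensional polytope. *)
Definition codeg (P : set 'rV[R]_n) : nat :=
  xget 0%N [set k | interior_lattice_dilate P k /\
    forall m, interior_lattice_dilate P m -> (k <= m)%N].

End Polytopes.

Arguments stable_set_polytope R {n} G.

(* Main.v *)
Require Import Defs.
From mathcomp Require Import all_boot all_order all_algebra.
From mathcomp Require Import all_classical all_reals all_analysis.
From mathcomp Require Import lra.

(** Lower bound.  Coordinates are nonnegative on the stable set polytope P, and
    for a clique K the coordinates in K sum to at most 1 on P, because a stable
    set meets K at most once.  On k P these inequalities become x_i >= 0 and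
    sum_(i in K) x_i <= k, and both are strict at an interior point
    ([interior_halfspace_lt]).  An interior lattice point therefore has all its
    coordinates at least 1, so #|K| <= sum_(i in K) x_i < k
    ([clique_lt_interior_lattice_dilate]).

    Upper bound.  The colour classes of a proper k-colouring are stable sets
    whose indicator vectors add up to the all-ones vector, which puts that
    vector in k P.  One more unit of dilation makes it an interior point: a
    nearby y is a slightly shrunken sum of the colour classes plus small
    nonnegative multiples of the unit vectors, of total weight at most k + 1
    ([colorable_interior_lattice_dilate]).  This also shows that the codegree
    is attained.

    For a perfect graph, the definition applied to the whole vertex set gives
    equality of the clique and chromatic numbers, and the two bounds meet. *)

Set Implicit Arguments.
Unset Strict Implicit.
Unset Printing Implicit Defensive.

Import Order.TTheory GRing.Theory Num.Theory.
Import numFieldNormedType.Exports.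

Local Open Scope classical_set_scope.
Local Open Scope ring_scope.

(** * Convex hulls, half-spaces and dilates *)

Section ConvexSets.
Variables (R : realType) (n : nat).
Implicit Types (C X D : set 'rV[R]_n) (x y : 'rV[R]_n) (w : 'I_n -> R).

Lemma convex_setP C : convex_set C <->
  forall x y (t : R), C x -> C y -> 0 <= t -> t <= 1 ->
    C (t *: x + (1 - t) *: y).
Proof.
split=> [cC x y t Cx Cy t0 t1 | cC x y l].
  by have := cC x y (Itv01 t0 t1) (mem_set Cx) (mem_set Cy); rewrite inE.
by rewrite !inE => Cx Cy; apply: cC.
Qed.

Lemma convex_set_convex_hull X : convex_set (convex_hull X).
Proof.
apply/convex_setP => x y t hx hy t0 t1 C [cC XC].
by apply: (convex_setP C).1 => //; [apply: hx | apply: hy].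
Qed.

Lemma sub_convex_hull X : X `<=` convex_hull X.
Proof. exact: sub_gen_smallest. Qed.

Lemma convex_set_halfspace w (c : R) :
  convex_set [set x : 'rV[R]_n | \sum_i w i * x 0 i <= c].
Proof.
apply/convex_setP => x y t /= hx hy t0 t1.
have -> : \sum_i w i * (t *: x + (1 - t) *: y) 0 i =
    t * (\sum_i w i * x 0 i) + (1 - t) * (\sum_i w i * y 0 i).
  rewrite !mulr_sumr -big_split; apply: eq_bigr => i _.
  by rewrite !mxE mulrDr !(mulrCA (w i)).
have -> : c = t * c + (1 - t) * c by rewrite -mulrDl addrC subrK mul1r.
by apply: lerD; apply: ler_wpM2l; rewrite ?subr_ge0.
Qed.

Lemma dilate_convex_hull_le w (c : R) X (k : nat) :
  (forall x, X x -> \sum_i w i * x 0 i <= c) ->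
  dilate k (convex_hull X) `<=` [set x | \sum_i w i * x 0 i <= k%:R * c].
Proof.
move=> Xc _ [x hx <-] /=.
have : \sum_i w i * x 0 i <= c.
  by apply: (smallest_sub (@convex_set_halfspace w c)) x hx => x /Xc.
move=> /(ler_wpM2l (ler0n R k)); apply: le_trans.
by rewrite mulr_sumr; apply: ler_sum => i _; rewrite mxE mulrCA.
Qed.

(** A nonzero linear form is strictly increased by a small step along a
    coordinate on which it does not vanish, so it cannot attain its bound at an
    interior point. *)
Lemma interior_halfspace_lt w (c : R) D x (i : 'I_n) :
  D `<=` [set y | \sum_i w i * y 0 i <= c] -> w i != 0 ->
  interior D x -> \sum_i w i * x 0 i < c.
Proof.
move=> Dc wi0 /nbhs_ballP[e /= e0 xeD].
(* Half the radius keeps the step in the ball; the sign makes the form grow. *)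
pose s : R := Num.sg (w i) * (e / 2).
have /xeD/Dc /= : ball x e (x + s *: delta_mx 0 i).
  split=> // a j; rewrite /ball /= !mxE opprD addrA subrr sub0r normrN.
  rewrite normrM {1}/s normrM normr_sg wi0 mul1r (gtr0_norm (divr_gt0 e0 (ltr0n R 2))).
  apply: le_lt_trans (_ : e / 2 < e); last by rewrite ltr_pdivrMr // ltr_pMr // ltr1n.
  by rewrite normr_nat ler_piMr ?divr_ge0 ?(ltW e0) // lern1 leq_b1.
apply: lt_le_trans.
have -> : \sum_j w j * (x + s *: delta_mx 0 i) 0 j =
    \sum_j w j * x 0 j + `|w i| * (e / 2).
  have <- : w i * s = `|w i| * (e / 2) by rewrite mulrA [w i * _]mulrC -normrEsg.
  under eq_bigr do rewrite !mxE mulrDr.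
  rewrite big_split /= [X in _ + X](bigD1 i) //= eqxx mulr1.
  rewrite [X in _ + (_ + X)]big1 ?addr0 // => j /negbTE ->.
  by rewrite !mulr0.
by rewrite ltrDl mulr_gt0 ?divr_gt0 ?normr_gt0.
Qed.

(** Convexity for unnormalised weights, which lets the combinations below be
    summed term by term and normalised only once. *)
Lemma convex_add_scaled C x y (a b : R) :
  convex_set C -> C x -> C y -> 0 <= a -> 0 <= b ->
  exists2 z, C z & a *: x + b *: y = (a + b) *: z.
Proof.
move=> cC Cx Cy a0 b0; have [ab0 | ab_neq0] := eqVneq (a + b) 0.
  (* Both weights vanish, so any point of C is a witness. *)
  move/eqP: (ab0); rewrite paddr_eq0 // => /andP[/eqP -> /eqP ->].
  by exists x => //; rewrite addr0 !scale0r addr0.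
have ab_gt0 : 0 < a + b by rewrite lt_def ab_neq0 addr_ge0.
exists ((a / (a + b)) *: x + (1 - a / (a + b)) *: y).
  apply: (convex_setP C).1 => //; first by rewrite divr_ge0 // ltW.
  by rewrite ler_pdivrMr // mul1r lerDl.
rewrite scalerDr !scalerA mulrBr mulr1 mulrCA divff // mulr1.
by rewrite [a + b]addrC addrK.
Qed.

Lemma convex_sum_scaled C (I : finType) (a : I -> R) (x : I -> 'rV[R]_n) :
  convex_set C -> C 0 -> (forall i, 0 <= a i) -> (forall i, C (x i)) ->
  exists2 z, C z & \sum_i a i *: x i = (\sum_i a i) *: z.
Proof.
move=> cC C0 a0 Cx.
suff [] : 0 <= \sum_i a i /\
    exists2 z, C z & \sum_i a i *: x i = (\sum_i a i) *: z by [].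
elim/big_ind2: _ => [|u p v q [p0 [y Cy ->]] [q0 [z Cz ->]]|i _].
- by split=> //; exists 0 => //; rewrite scaler0.
- by split; [exact: addr_ge0 | exact: convex_add_scaled].
- by split; [exact: a0 | exists (x i)].
Qed.

(** The missing weight [k%:R - a] is put on the origin. *)
Lemma dilate_mono C x (a : R) (k : nat) :
  convex_set C -> C 0 -> C x -> 0 <= a -> a <= k%:R -> dilate k C (a *: x).
Proof.
move=> cC C0 Cx a0; rewrite -subr_ge0 => b0.
have [z Cz] := convex_add_scaled cC Cx C0 a0 b0.
by rewrite scaler0 addr0 addrC subrK => ->; exists z.
Qed.

(** By well-ordering, one interior lattice point in some dilate is enough for
    the codegree to be a genuine minimum. *)
Lemma codeg_min (P : set 'rV[R]_n) (m : nat) :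
  interior_lattice_dilate P m ->
  interior_lattice_dilate P (codeg P) /\ (codeg P <= m)%N.
Proof.
move=> Pm; have exP : exists k, `[< interior_lattice_dilate P k >].
  by exists m; apply/asboolP.
have exmin : exists k, [set k | interior_lattice_dilate P k /\
    forall m, interior_lattice_dilate P m -> (k <= m)%N] k.
  case: (ex_minnP exP) => k /asboolP Pk kmin; exists k; split=> // j Pj.
  by apply: kmin; apply/asboolP.
by have [Pk kmin] := xgetPex 0%N exmin; split; last exact: kmin.
Qed.

End ConvexSets.

(** * The stable set polytope *)

Section StableSets.
Variables (R : realType) (n : nat) (G : sgraph 'I_n).

Lemma indicator_vectorE (A : {set 'I_n}) (i : 'I_n) :
  indicator_vector R A 0 i = (i \in A)%:R.
Proof.
rewrite /indicator_vector summxE; have [iA | niA] := boolP (i \in A).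
  rewrite (bigD1 i) //= mxE !eqxx big1 ?addr0 // => j /andP[_].
  by rewrite mxE eq_sym => /negbTE ->.
rewrite big1 // => j jA; rewrite mxE /=.
by case: eqP => // ij; rewrite ij jA in niA.
Qed.

Lemma stable_color_class k (f : {ffun 'I_n -> 'I_k}) (c : 'I_k) :
  [forall i, forall j, edge G i j ==> (f i != f j)] ->
  stable G [set i | f i == c]%SET.
Proof.
move=> /forallP fP; apply/'forall_implyP => i; rewrite inE => /eqP fi.
apply/'forall_implyP => j; rewrite inE => /eqP fj; apply/implyP => _.
by apply/negP => /(implyP (forallP (fP i) j)); rewrite fi fj eqxx.
Qed.

Lemma stable_set1 (i : 'I_n) : stable G [set i]%SET.
Proof.
apply/'forall_implyP => a /set1P ->; apply/'forall_implyP => b /set1P ->.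
by rewrite eqxx.
Qed.

Lemma stable_set0 : stable G finset.set0.
Proof. by apply/'forall_implyP => a; rewrite inE. Qed.

Lemma card_stable_clique (S K : {set 'I_n}) :
  stable G S -> clique G K -> (#|S :&: K| <= 1)%N.
Proof.
move=> /'forall_implyP sS /'forall_implyP cK; apply/card_le1_eqP => i j.
move=> /setIP[iS iK] /setIP[jS jK]; apply/eqP/negPn/negP => ij.
have /'forall_implyP/(_ j jS) := sS i iS.
by have /'forall_implyP/(_ j jK) := cK i iK; rewrite eq_sym ij /= => ->.
Qed.

Lemma indicator_stable_set_polytope (S : {set 'I_n}) :
  stable G S -> stable_set_polytope R G (indicator_vector R S).
Proof. by move=> sS; apply: sub_convex_hull; exists S. Qed.

Lemma sum_indicator_vector (w : 'I_n -> R) (S : {set 'I_n}) :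
  \sum_i w i * indicator_vector R S 0 i = \sum_(i in S) w i.
Proof.
rewrite [RHS]big_mkcond; apply: eq_bigr => i _.
by rewrite indicator_vectorE; case: (i \in S); rewrite ?mulr1 ?mulr0.
Qed.

(** An integer coordinate that is positive is at least 1; positivity is the
    strict form of the valid inequality [- x_i <= 0]. *)
Lemma interior_lattice_dilate_coord_ge1 (k : nat) (x : 'rV[R]_n) (i : 'I_n) :
  lattice_point x -> interior (dilate k (stable_set_polytope R G)) x ->
  1 <= x 0 i.
Proof.
move=> /(_ i)/intrP[m xm] xint.
(* Nonnegativity of x_i, written as an upper bound on a linear form. *)
have : \sum_j - (j == i)%:R * x 0 j < k%:R * 0.
  apply: (interior_halfspace_lt (i := i)) xint.
    apply: dilate_convex_hull_le => _ [S _ <-].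
    by rewrite sum_indicator_vector sumrN oppr_le0 sumr_ge0.
  by rewrite eqxx oppr_eq0 oner_eq0.
rewrite mulr0 (bigD1 i) //= eqxx big1 ?addr0 => [|j /negbTE ->].
  by rewrite mulN1r oppr_lt0 xm ltr0z ler1z gtz0_ge1.
by rewrite oppr0 mul0r.
Qed.

(** The lower bound: the clique inequality is strict at an interior point, and
    each of the #|K| coordinates that it adds up is at least 1. *)
Lemma clique_lt_interior_lattice_dilate (K : {set 'I_n}) (k : nat) :
  clique G K -> interior_lattice_dilate (stable_set_polytope R G) k ->
  (#|K| < k)%N.
Proof.
move=> cK [k0 [x [xZ xint]]]; have [-> | [i iK]] := set_0Vmem K.
  by rewrite cards0.
(* The inequality sum_(j in K) x_j <= 1 of P, scaled by k and made strict. *)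
have : \sum_j (j \in K)%:R * x 0 j < k%:R * 1.
  apply: (interior_halfspace_lt (i := i)) xint; last by rewrite iK oner_eq0.
  apply: dilate_convex_hull_le => _ [S sS <-]; rewrite sum_indicator_vector.
  rewrite -natr_sum lern1 -big_mkcondr /= sum1_card -cardsE.
  apply: leq_trans (card_stable_clique sS cK); apply: subset_leq_card.
  by apply/fintype.subsetP => j; rewrite !inE.
rewrite mulr1 -(ltr_nat R); apply: le_lt_trans.
rewrite -sum1_card natr_sum big_mkcond; apply: ler_sum => j _.
case: (j \in K); last by rewrite mul0r.
by rewrite mul1r (interior_lattice_dilate_coord_ge1 _ xZ xint).
Qed.

(** The upper bound: with colour classes S_c and |y_i - 1| < e,
      y = sum_c (1 - e) e_(S_c) + sum_i (y_i - (1 - e)) e_i,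
    where all weights are nonnegative, the first ones sum to at most k and the
    last ones to at most n (2 e). *)
Lemma colorable_interior_lattice_dilate (k : nat) :
  colorable G k -> interior_lattice_dilate (stable_set_polytope R G) k.+1.
Proof.
move=> /existsP[f fP]; split=> //; exists (const_mx 1); split.
  by move=> i; rewrite mxE int_num1.
(* Chosen so that n (2 e) <= 1; the successor keeps the inverse meaningful for
   every n. *)
pose e : R := (2 * n.+1%:R)^-1.
have e0 : 0 < e by rewrite invr_gt0 mulr_gt0 ?ltr0n.
have e1 : e <= 1.
  by rewrite invf_le1 ?mulr_gt0 ?ltr0n // -natrM ler1n.
have ne1 : n%:R * (2 * e) <= 1 :> R.
  by rewrite /e invfM mulVKf ?pnatr_eq0 // ler_pdivrMr ?ltr0n // mul1r ler_nat.
apply/nbhs_ballP; exists e => // y [_ /(_ 0) ye].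
have ye' i : `|1 - y 0 i| < e by have := ye i; rewrite /ball /= mxE.
have yl i : 0 <= y 0 i - (1 - e) by have := ye' i; rewrite ltr_norml; lra.
have yu i : y 0 i - (1 - e) <= 2 * e by have := ye' i; rewrite ltr_norml; lra.
have cP : convex_set (stable_set_polytope R G) by exact: convex_set_convex_hull.
have P0 : stable_set_polytope R G 0.
  have := indicator_stable_set_polytope stable_set0.
  by rewrite /indicator_vector big_set0.
have [u Pu uE] := convex_sum_scaled (a := fun=> 1 - e) cP P0
  (fun c : 'I_k => ltac:(by rewrite subr_ge0))
  (fun c => indicator_stable_set_polytope (stable_color_class c fP)).
have [v Pv vE] := convex_sum_scaled cP P0 yl
  (fun i => indicator_stable_set_polytope (stable_set1 i)).
have a0 : 0 <= \sum_(c < k) (1 - e) by rewrite sumr_ge0 // subr_ge0.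
have b0 : 0 <= \sum_i (y 0 i - (1 - e)) by exact: sumr_ge0.
have [z Pz zE] := convex_add_scaled cP Pu Pv a0 b0.
suff -> : y = (\sum_(c < k) (1 - e) + \sum_i (y 0 i - (1 - e))) *: z.
  apply: dilate_mono => //; first exact: addr_ge0.
  rewrite -natr1 lerD //.
    by rewrite sumr_const card_ord lerMn2r gerBl ltW ?orbT.
  apply: le_trans ne1; rewrite mulr_natl -[X in _ *+ X]card_ord -sumr_const.
  exact: ler_sum.
rewrite -zE -uE -vE; apply/rowP => i; rewrite mxE !summxE.
(* Only the class of colour f i and the unit vector e_i contribute at i. *)
rewrite (bigD1 (f i)) //= mxE indicator_vectorE inE eqxx big1 => [|c].
  rewrite (bigD1 i) //= mxE indicator_vectorE inE eqxx big1 => [|j].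
    by rewrite !mulr1 !addr0 addrC subrK.
  by rewrite mxE indicator_vectorE inE eq_sym => /negbTE ->; rewrite mulr0.
by rewrite mxE indicator_vectorE inE eq_sym => /negbTE ->; rewrite mulr0.
Qed.

End StableSets.

(** * Induced subgraphs *)

Section InducedSubgraphs.
Variables (V : finType) (G : sgraph V).

Lemma clique_number_induced (A : {set V}) :
  (clique_number (Defs.induced G A) <= clique_number G)%N.
Proof.
apply/bigmax_leqP => K /'forall_implyP cK.
rewrite -(card_imset _ val_inj); apply: (leq_bigmax_cond (val @: K)).
apply/'forall_implyP => _ /imsetP[i iK ->].
apply/'forall_implyP => _ /imsetP[j jK ->].
by have /'forall_implyP/(_ j jK) := cK i iK; rewrite (inj_eq val_inj).
Qed.

Lemma chromatic_number_induced_setT :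
  (chromatic_number G <= chromatic_number (Defs.induced G [set: V]))%N.
Proof.
rewrite {2}/chromatic_number; case: ex_minnP => k /existsP[f /forallP fP] _.
rewrite /chromatic_number; case: ex_minnP => m _; apply.
apply/existsP; exists [ffun i => f (exist _ i (finset.in_setT i))].
apply/forallP => i; apply/forallP => j; rewrite !ffunE.
exact: (forallP (fP (exist _ i (finset.in_setT i))) (exist _ j (finset.in_setT j))).
Qed.

End InducedSubgraphs.

Theorem theorem1p1 (R : realType) (n : nat) (hn : (1 <= n)%N)
    (G : sgraph 'I_n) :
  ((clique_number G + 1 <= codeg (stable_set_polytope R G))%N /\
   (codeg (stable_set_polytope R G) <= chromatic_number G + 1)%N) /\
  (perfect G ->
   (clique_number G + 1)%N = codeg (stable_set_polytope R G) /\
   codeg (stable_set_polytope R G) = (chromatic_number G + 1)%N).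
Proof.
have Gchi : colorable G (chromatic_number G).
  by rewrite /chromatic_number; case: ex_minnP.
have [Pcodeg codeg_le] :=
  codeg_min (colorable_interior_lattice_dilate R Gchi).
have codeg_ge : (clique_number G + 1 <= codeg (stable_set_polytope R G))%N.
  rewrite addn1 -(prednK Pcodeg.1) ltnS; apply/bigmax_leqP => K cK.
  by rewrite -ltnS (prednK Pcodeg.1) (clique_lt_interior_lattice_dilate cK Pcodeg).
rewrite -addn1 in codeg_le; split=> // perfG.
have omega_chi : (chromatic_number G <= clique_number G)%N.
  apply: leq_trans (chromatic_number_induced_setT G) _.
  by rewrite -perfG clique_number_induced.
split; apply/eqP; rewrite eqn_leq.
  rewrite codeg_ge (leq_trans codeg_le) //.
  by rewrite leq_add2r.
by rewrite codeg_le (leq_trans _ codeg_ge) // leq_add2r.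
Qed.
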